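(* Consider the switching retarded system $\Sigma_r=(\mathcal{C},\mathrm{PC},\phi)$ described in the context, and suppose there exists $L>0$ such that $|f_q(\psi_1)-f_q(\psi_2)|\le L\|\psi_1-\psi_2\|$ for all $\psi_1,\psi_2\in\mathcal{C}$ and $q\in\mathcal{Q}$. Then the following are equivalent: (i) $\Sigma_r$ is UGES; (ii) there exist a continuous functional $V:\mathcal{C}\to\mathbb{R}_+$ and positive reals $p,\underline{c},\overline{c}$ such that $\underline{c}\|\psi\|^p\le V(\psi)\le\overline{c}\|\psi\|^p$ for all $\psi\in\mathcal{C}$ and $\overline{D}_qV(\psi)\le-\|\psi\|^p$ for all $\psi\in\mathcal{C}$, $q\in\mathcal{Q}$; (iii) there exist a functional $V:\mathcal{C}\to\mathbb{R}_+$ and positive reals $p,c$ such that for every $\psi\in\mathcal{C}$ and $q\in\mathcal{Q}$ the map $t\mapsto V(T_q(t)\psi)$ is continuous from the left, $\overline{D}_qV(\psi)\le-\|\psi\|^p$ for all $\psi\in\mathcal{C}$, $q\in\mathcal{Q}$, and $V(\psi)\le c\|\psi\|^p$ for all $\psi\in\mathcal{C}$.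
   Context: Let $r\ge0$, $n\ge1$, and $\mathcal{C}=\mathcal{C}([-r,0],\mathbb{R}^n)$ with the sup norm $\|\cdot\|$. Let $\mathcal{Q}$ be a nonempty set and for each $q\in\mathcal{Q}$ let $f_q:\mathcal{C}\to\mathbb{R}^n$ be continuous with $f_q(0)=0$. Consider $\dot x(t)=f_{\sigma(t)}(x_t)$, $t\ge0$, $x(\theta)=\varphi(\theta)$ for $\theta\in[-r,0]$, with $\varphi\in\mathcal{C}$, where $x_t(\theta)=x(t+\theta)$, $\theta\in[-r,0]$, and $\sigma$ belongs to the set $\mathrm{PC}$ of piecewise constant functions $\mathbb{R}_+\to\mathcal{Q}$. Assume that for every $q\in\mathcal{Q}$ and $\varphi\in\mathcal{C}$ the system with $\sigma\equiv q$ has a unique solution on $[-r,+\infty)$, and set $T_q(t)\varphi=x_t$ (a strongly continuous nonlinear semigroup on $\mathcal{C}$). For $\sigma\in\mathrm{PC}$ equal to $\sigma_k$ on $[t_k,t_{k+1})$ with $0=t_0<t_1<\cdots$, define $\phi(t,\varphi,\sigma)=T_{\sigma_k}(t-t_k)T_{\sigma_{k-1}}(t_k-t_{k-1})\cdots T_{\sigma_0}(t_1)\varphi$ for $t\in[t_k,t_{k+1})$; this gives $\Sigma_r=(\mathcal{C},\mathrm{PC},\phi)$. $\Sigma_r$ is UGES if there exist $M,\lambda>0$ with $\|\phi(t,\varphi,\sigma)\|\le Me^{-\lambda t}\|\varphi\|$ for all $t\ge0$, $\varphi\in\mathcal{C}$, $\sigma\in\mathrm{PC}$. For $q\in\mathcal{Q}$,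 $\overline{D}_qV(\psi)=\limsup_{h\downarrow0}\frac1h\big(V(T_q(h)\psi)-V(\psi)\big)$. *)

(* Defs.v *)
(* reals are an arbitrary R : realType,
   R^n is 'rV[R]_n with MathComp's (max) norm `|.|. *)
From HB Require Import structures.
From mathcomp Require Import all_boot all_order all_algebra.
From mathcomp Require Import all_classical all_reals all_analysis.
Set Implicit Arguments. Unset Strict Implicit. Unset Printing Implicit Defensive.
Import Order.TTheory GRing.Theory Num.Def Num.Theory.
Import numFieldNormedType.Exports.
Local Open Scope classical_set_scope.
Local Open Scope ring_scope.

Definition clamp {R : realType} (r s : R) : R := Num.max (- r) (Num.min s 0).

(* An element of C([-r,0], R^n) is represented by its canonical extension to R,
   constant outside [-r,0]: continuity on R of such an extension is equivalent to
   continuity on [-r,0], and the representation is a bijection. *)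
Definition is_phase {R : realType} (r : R) (n : nat) (phi : R -> 'rV[R]_n) : Prop :=
  continuous phi /\ forall s, phi s = phi (clamp r s).

Definition phase (R : realType) (r : R) (n : nat) :=
  {phi : R -> 'rV[R]_n | is_phase r phi}.

Definition segI {R : realType} (r : R) : set R := [set th | - r <= th <= 0].

Definition cnorm {R : realType} {r : R} {n : nat} (psi : phase r n) : R :=
  sup [set `|proj1_sig psi th| | th in segI r].

Definition cdist {R : realType} {r : R} {n : nat} (psi1 psi2 : phase r n) : R :=
  sup [set `|proj1_sig psi1 th - proj1_sig psi2 th| | th in segI r].

Definition ccontinuous {R : realType} {r : R} {n : nat} {W : normedModType R}
  (F : phase r n -> W) : Prop :=
  forall psi (e : R), 0 < e -> exists d : R, 0 < d /\
    forall psi', cdist psi psi' < d -> `|F psi - F psi'| < e.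

(* x : [-r,+oo) -> R^n (represented as a function on R; only values on [-r,+oo)
   matter) is a solution of  x'(t) = f_q(x_t), t >= 0,  x = phi on [-r,0].
   xs t is the history segment x_t (for t >= 0); the derivative at t = 0 is
   the right derivative. *)
Definition is_solution {R : realType} {r : R} {n : nat} {Q : Type}
  (f : Q -> phase r n -> 'rV[R]_n) (q : Q) (phi : phase r n)
  (x : R -> 'rV[R]_n) : Prop :=
  exists xs : R -> phase r n,
    (forall t th : R, 0 <= t -> segI r th -> proj1_sig (xs t) th = x (t + th)) /\
    (forall th : R, segI r th -> x th = proj1_sig phi th) /\
    {within [set t : R | - r <= t], continuous x} /\
    (h^-1 *: (x h - x 0) @[h --> (0:R)^'+] --> f q (xs 0)) /\
    (forall t : R, 0 < t -> is_derive t 1 x (f q (xs t))).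

Definition switching_times {R : realType} (ts : nat -> R) : Prop :=
  ts 0%N = 0 /\ (forall k, ts k < ts k.+1) /\ (forall M, exists k, M < ts k).

Fixpoint sw_state {R : realType} {r : R} {n : nat} {Q : Type}
  (T : Q -> R -> phase r n -> phase r n) (qs : nat -> Q) (ts : nat -> R)
  (phi : phase r n) (k : nat) : phase r n :=
  match k with
  | 0%N => phi
  | k'.+1 => T (qs k') (ts k'.+1 - ts k') (sw_state T qs ts phi k')
  end.

(* phi(t, phi, sigma) for sigma = qs k on [ts k, ts k.+1) and t in that interval *)
Definition sw_flow {R : realType} {r : R} {n : nat} {Q : Type}
  (T : Q -> R -> phase r n -> phase r n) (qs : nat -> Q) (ts : nat -> R)
  (phi : phase r n) (k : nat) (t : R) : phase r n :=
  T (qs k) (t - ts k) (sw_state T qs ts phi k).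

(* uniform global exponential stability of Sigma_r; a piecewise constant
   sigma in PC is given by its switching instants ts and modes qs *)
Definition UGES {R : realType} {r : R} {n : nat} {Q : Type}
  (T : Q -> R -> phase r n -> phase r n) : Prop :=
  exists M lam : R, 0 < M /\ 0 < lam /\
    forall (qs : nat -> Q) (ts : nat -> R), switching_times ts ->
    forall (phi : phase r n) (k : nat) (t : R), ts k <= t < ts k.+1 ->
      cnorm (sw_flow T qs ts phi k t) <= M * expR (- lam * t) * cnorm phi.

Definition upper_dini {R : realType} {r : R} {n : nat} {Q : Type}
  (T : Q -> R -> phase r n -> phase r n) (V : phase r n -> R)
  (q : Q) (psi : phase r n) : \bar R :=
  limf_esup (fun h : R => ((V (T q h psi) - V psi) / h)%:E) (0:R)^'+.

(* Main.v *)
Require Import Defs.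
From HB Require Import structures.
From mathcomp Require Import all_boot all_order all_algebra.
From mathcomp Require Import all_classical all_reals all_analysis.
From mathcomp Require Import ring lra.
Import Order.TTheory GRing.Theory Num.Def Num.Theory.
Import numFieldNormedType.Exports.
Local Open Scope classical_set_scope.
Local Open Scope ring_scope.

(* Write mu for half the decay rate. If the system is UGES, the functional
   V(psi) = (2 / mu) sup_(sigma, t) e^(mu t) |phi(t, psi, sigma)| contracts by
   e^(-mu h) along every mode, since running mode q for a time h and then
   following sigma is again an admissible switching; it is continuous because the
   flow is Lipschitz up to any fixed time and the tail of the supremum is
   uniformly small. Conversely, a functional V as in (iii) has no lower bound, but
   the Lipschitz assumption gives D(|psi|^p) <= L p |psi|^p, so that
   (2 L p + 1) V + |psi|^p still decays at an exponential rate, and it dominates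
   |psi|^p. Every differential inequality is integrated by a Gronwall lemma for
   left-continuous functions with a one-sided Dini bound, which is also the source
   of the Lipschitz estimate for the flow. *)

(** * Dini comparison and the Gronwall estimate *)

Lemma near_at_right0P {R : realType} (P : R -> Prop) :
  (\forall h \near (0:R)^'+, P h) <->
  exists d : R, 0 < d /\ forall h, 0 < h < d -> P h.
Proof.
split.
- move=> /nbhs_ballP[d /= d0 dP]; exists d; split=> // h /andP[h0 hd].
  by apply: dP => //=; rewrite /ball/= sub0r normrN gtr0_norm.
- move=> [d [d0 dP]]; near=> h; apply: dP; apply/andP; split.
    by near: h; exact: nbhs_right_gt.
  by near: h; exact: nbhs_right_lt.
Unshelve. all: by end_near. Qed.

(** The graph stays below every line of slope [e > 0] through [(a, w a)]: left continuity keeps the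
    bound at the last time up to which it holds, and the right-hand Dini bound carries it further
    unless that time is [b]. *)
Lemma dini_nonincreasing {R : realType} (w : R -> R) (a b : R) : a <= b ->
  (forall t, a < t <= b -> w s @[s --> t^'-] --> w t) ->
  (forall t, a <= t < b -> forall e : R, 0 < e ->
     \forall h \near (0:R)^'+, w (t + h) <= w t + e * h) ->
  w b <= w a.
Proof.
move=> ab wl wr.
suff H (e : R) : 0 < e -> w b <= w a + e * (b - a).
  apply/ler_addgt0Pr => e e0.
  (* The [+ 1] keeps the denominator positive when [a = b]. *)
  have d0 : 0 < b - a + 1 by lra.
  have := H (e / (b - a + 1)) (divr_gt0 e0 d0).
  move/le_trans; apply; rewrite lerD2l -mulrA ler_piMr ?(ltW e0)//.
  by rewrite mulrC ler_pdivrMr//; lra.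
move=> e0.
pose S := [set t | a <= t <= b /\
  forall s, a <= s <= t -> w s <= w a + e * (s - a)].
have Sa : S a.
  split; first by rewrite lexx.
  by move=> s /le_anti <-; rewrite subrr mulr0 addr0.
have Sb : ubound S b by move=> t [/andP[]].
have Ss : has_sup S by split; [exists a|exists b].
pose c := sup S.
have ac : a <= c by apply: ub_le_sup => //; exists b.
have cb : c <= b by apply: ge_sup => //; exists a.
have Slt s : a <= s < c -> w s <= w a + e * (s - a).
  move=> /andP[as_ sc]; have [t [_ St] st] := sup_gt (ex_intro _ a Sa) sc.
  by apply: St; rewrite as_ ltW.
have Sc : w c <= w a + e * (c - a).
  have [->|ca] := eqVneq c a; first by rewrite subrr mulr0 addr0.
  have {}ac : a < c by rewrite lt_neqAle eq_sym ca.
  have /cvgr_dist_lt wc := wl c (introT andP (conj ac cb)).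
  rewrite leNgt; apply/negP => lt_wc.
  have /wc{wc}wc : 0 < w c - (w a + e * (c - a)) by rewrite subr_gt0.
  have [s [/= s1 /andP[s2 s3]]] : exists s,
      `|w c - w s| < w c - (w a + e * (c - a)) /\ a <= s < c.
    apply: (@filter_ex _ c^'-); near=> s; split; first by near: s.
    apply/andP; split; last by near: s; exact: nbhs_left_lt.
    by near: s; exact: nbhs_left_ge.
  have := Slt s; rewrite s2 s3 => /(_ isT) ws.
  have : e * (s - a) <= e * (c - a) by rewrite ler_pM2l// lerD2r ltW.
  by move: s1; rewrite ltr_norml => /andP[_]; lra.
suff <- : c = b by [].
apply/eqP; rewrite eq_le cb leNgt; apply/negP => {}cb.
have := wr c; rewrite ac cb => /(_ isT _ e0) /near_at_right0P[d [d0 dP]].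
pose h := Num.min (d / 2) (b - c).
have h0 : 0 < h by rewrite lt_min divr_gt0//= subr_gt0.
have hd : h < d by rewrite gt_min ltr_pdivrMr//; apply/orP; left; lra.
have hb : h <= b - c by rewrite ge_min lexx orbT.
have : S (c + h).
  split; first by apply/andP; split; lra.
  move=> s /andP[as_ sc].
  have [lt_sc|le_cs] := ltP s c; first by apply: Slt; rewrite as_.
  have [->//|ne_sc] := eqVneq s c.
  have lt_cs : c < s by rewrite lt_neqAle eq_sym ne_sc.
  have := dP (s - c); rewrite (addrC c) subrK.
  have -> : 0 < s - c < d by apply/andP; split; lra.
  move=> /(_ isT) ws; nra.
move=> /(ub_le_sup (ex_intro _ b Sb)); rewrite -/c; lra.
Unshelve. all: by end_near. Qed.

(** Since [1 + k * h <= expR (k * h)], the weighted function [expR (- (k * t)) * G t] falls under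
    [dini_nonincreasing]. *)
Lemma dini_gronwall {R : realType} (G : R -> R) (k b : R) : 0 <= b ->
  (forall t, 0 <= t -> 0 <= G t) ->
  (forall t, 0 < t -> G s @[s --> t^'-] --> G t) ->
  (forall t, 0 <= t -> forall e : R, 0 < e ->
     \forall h \near (0:R)^'+, G (t + h) <= (1 + k * h) * G t + e * h) ->
  G b <= expR (k * b) * G 0.
Proof.
move=> b0 G0 Gl Gr.
suff : expR (- (k * b)) * G b <= expR (- (k * 0)) * G 0.
  by rewrite mulr0 oppr0 expR0 mul1r expRN mulrC ler_pdivrMr ?expR_gt0// mulrC.
apply: (@dini_nonincreasing _ (fun t => expR (- (k * t)) * G t)) => //.
- move=> t /andP[t0 _]; apply: cvgM; last exact: Gl.
  apply: (@cvg_at_left_filter _ _ (fun s => expR (- (k * s)))).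
  apply: (@continuous_comp _ _ _ (fun s => - (k * s)) expR).
    by apply: continuousN; apply: continuousM; [exact: cvg_cst|exact: cvg_id].
  exact: continuous_expR.
move=> t /andP[t0 tb] e e0.
(* [B] bounds [expR (- (k * (t + h)))] for [h < 1], so asking [G] for the error [e / B] leaves at
   most [e * h] after weighting. *)
pose B := expR (`|k| * (t + 1)).
have B0 : 0 < B by exact: expR_gt0.
have := Gr t t0 _ (divr_gt0 e0 B0); apply: filter_app; near=> h => Gh.
have h0 : 0 < h by near: h; exact: nbhs_right_gt.
have h1 : h < 1 by near: h; exact: nbhs_right_lt.
apply: (le_trans (ler_wpM2l (ltW (expR_gt0 _)) Gh)).
rewrite mulrDr lerD//.
  rewrite mulrA ler_wpM2r ?G0//.
  rewrite (mulrDr k) opprD expRD -mulrA ler_piMr ?expR_ge0//.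
  by rewrite expRN ler_pdivrMl ?expR_gt0// mulr1 expR_ge1Dx.
rewrite mulrA ler_wpM2r ?(ltW h0)// mulrCA ler_piMr ?(ltW e0)//.
rewrite ler_pdivrMr// mul1r ler_expR -mulrN.
apply: (le_trans (ler_norm _)); rewrite normrM ler_wpM2l//.
by rewrite normrN ger0_norm; lra.
Unshelve. all: by end_near. Qed.

(** Freezing [x] to the left of [a] turns continuity on a half-line into continuity on the whole
    line, which composes freely with shifts. *)
Lemma within_ge_continuous {R : realType} {X : topologicalType} (a : R)
    (x : R -> X) :
  {within [set t | a <= t], continuous x} ->
  continuous (fun s => x (Num.max a s)).
Proof.
move=> /subspace_continuousP xc s.
have am : [set t | a <= t] (Num.max a s) by rewrite /= le_max lexx.
apply: (@cvg_comp _ _ _ (Num.max a) x _ _ _ _ (xc _ am)).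
have mc : {for s, continuous (Num.max a)}.
  have -> : Num.max a = (fun s => (a + s + `|a - s|) / 2).
    by apply/funext => z; rewrite maxr_absE.
  apply: cvgM; last exact: cvg_cst.
  apply: cvgD; first by apply: cvgD; [exact: cvg_cst|exact: cvg_id].
  by apply: cvg_norm; apply: cvgB; [exact: cvg_cst|exact: cvg_id].
move=> P; rewrite /within/= => /mc; rewrite !nbhs_simpl/= => maP.
apply: filterS maP => z /=; apply.
by rewrite le_max lexx.
Qed.

(** * The sup distance on the phase space *)

Section Phase.
Context {R : realType} {r : R} {n : nat}.
Implicit Types psi : phase r n.

(** [clamp] sends every real into the segment as soon as [0 <= r], so a representative has no
    freedom outside it. *)
Lemma phase_eq psi1 psi2 :
  (forall th, segI r th -> proj1_sig psi1 th = proj1_sig psi2 th) ->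
  0 <= r -> psi1 = psi2.
Proof.
case: psi1 psi2 => [u [uc uE]] [v [vc vE]] /= uv r0.
apply: eq_exist; apply/funext => s; rewrite uE vE; apply: uv.
by rewrite /segI/= /clamp le_max lexx/= ge_max oppr_le0 r0 ge_min lexx orbT.
Qed.

Lemma phase0_subproof : is_phase r (fun _ : R => 0 : 'rV[R]_n).
Proof. by split=> // s; exact: cvg_cst. Qed.

Definition phase0 : phase r n := exist _ _ phase0_subproof.

Lemma cnorm_cdist psi : cnorm psi = cdist psi phase0.
Proof.
rewrite /cnorm /cdist; congr sup.
by apply: eq_imagel => th _ /=; rewrite subr0.
Qed.

Lemma cdistC psi1 psi2 : cdist psi1 psi2 = cdist psi2 psi1.
Proof.
by rewrite /cdist; congr sup; apply: eq_imagel => th _ /=; rewrite distrC.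
Qed.

Hypothesis r0 : 0 <= r.

Lemma le_cdist psi1 psi2 th : segI r th ->
  `|proj1_sig psi1 th - proj1_sig psi2 th| <= cdist psi1 psi2.
Proof.
move=> rth; apply: ub_le_sup; last by exists th.
have nr : - r <= 0 by rewrite oppr_le0.
(* The extreme value theorem bounds the set of distances, so that [sup] is a genuine supremum and
   not a default value. *)
have [|c _ cP] := @EVT_max R
  (fun s => `|proj1_sig psi1 s - proj1_sig psi2 s|) (- r) 0 nr.
  apply: continuous_subspaceT => s; apply: continuous_comp.
    apply: (@continuousB _ _ _ (proj1_sig psi1) (proj1_sig psi2)).
    - exact: (proj1 (proj2_sig psi1)).
    - exact: (proj1 (proj2_sig psi2)).
  exact: norm_continuous.
by exists `|proj1_sig psi1 c - proj1_sig psi2 c| => _ [s rs <-]; exact: cP.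
Qed.

Lemma cdist_le psi1 psi2 B : (forall th, segI r th ->
  `|proj1_sig psi1 th - proj1_sig psi2 th| <= B) -> cdist psi1 psi2 <= B.
Proof.
move=> H; apply: ge_sup.
  exists `|proj1_sig psi1 0 - proj1_sig psi2 0|, 0 => //.
  by rewrite /segI/= oppr_le0 r0 lexx.
by move=> _ [s rs <-]; exact: H.
Qed.

Lemma cdist_ge0 psi1 psi2 : 0 <= cdist psi1 psi2.
Proof.
apply: (le_trans (normr_ge0 (proj1_sig psi1 0 - proj1_sig psi2 0))).
by apply: le_cdist; rewrite /segI/= oppr_le0 r0 lexx.
Qed.

Lemma cdist_triangle psi1 psi2 psi3 :
  cdist psi1 psi3 <= cdist psi1 psi2 + cdist psi2 psi3.
Proof.
apply: cdist_le => th rth; apply: (le_trans (ler_distD (proj1_sig psi2 th) _ _)).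
by rewrite lerD// le_cdist.
Qed.

Lemma cnorm_ge0 psi : 0 <= cnorm psi.
Proof. by rewrite cnorm_cdist cdist_ge0. Qed.

Lemma cnorm_le_cdist psi1 psi2 : cnorm psi1 <= cnorm psi2 + cdist psi1 psi2.
Proof. by rewrite !cnorm_cdist addrC cdist_triangle. Qed.

End Phase.

(** * Flow of a single mode: semigroup law, left continuity, Lipschitz bound *)

Section Flow.
Context {R : realType} {r : R} {n : nat} {Q : Type}.
Context {f : Q -> phase r n -> 'rV[R]_n}.
Context {T : Q -> R -> phase r n -> phase r n}.
Hypothesis r0 : 0 <= r.
Hypothesis f0 : forall q (psi : phase r n),
  (forall s, proj1_sig psi s = 0) -> f q psi = 0.
Hypothesis f_uniq : forall q phi x y,
  is_solution f q phi x -> is_solution f q phi y ->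
  forall t, - r <= t -> x t = y t.
Hypothesis T_solution : forall q phi, exists x, is_solution f q phi x /\
  forall t th, 0 <= t -> segI r th -> proj1_sig (T q t phi) th = x (t + th).

Lemma flow0 q phi : T q 0 phi = phi.
Proof.
have [x [[xs [_ [x_phi _]]] TE]] := T_solution q phi.
by apply: phase_eq => // th rth; rewrite TE// add0r x_phi.
Qed.

(** The zero curve is a solution and uniqueness does the rest. Comparison with it will turn the
    Lipschitz bound into a growth bound on the norm. *)
Lemma flow_phase0 q t : 0 <= t -> T q t phase0 = phase0.
Proof.
move=> t0; have [x [x_sol TE]] := T_solution q phase0.
apply: phase_eq => // th rth; rewrite TE//=.
have sol0 : is_solution f q phase0 (fun=> 0).
  have fp0 : f q phase0 = 0 by exact: f0.
  exists (fun=> phase0); split=> //; split=> //; split; first exact: cst_continuous.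
  rewrite fp0; split; last by move=> s _; exact: is_derive_cst.
  by under eq_fun do rewrite subrr scaler0; exact: cvg_cst.
apply: (f_uniq _ _ _ _ x_sol sol0).
by case/andP: rth => rth _; apply: (le_trans rth); rewrite lerDr.
Qed.

(** The equation is autonomous; with uniqueness this gives the semigroup law. Taking [0 < t]
    provides a two-sided derivative at the new origin, hence the right derivative required there. *)
Lemma is_solution_shift q phi x t : 0 < t -> is_solution f q phi x ->
  (forall th, segI r th -> proj1_sig (T q t phi) th = x (t + th)) ->
  is_solution f q (T q t phi) (fun s => x (t + s)).
Proof.
move=> t0 [xs [xsE [_ [xc [_ xd]]]]] TE.
have xd_shift (s : R) : 0 <= s ->
    is_derive s 1 (fun s => x (t + s)) (f q (xs (t + s))).
  move=> s0; have ts0 : 0 < t + s by rewrite ltr_wpDr.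
  have xE : (fun h : R => h^-1 *: (((fun s => x (t + s)) \o shift s) (h *: 1)
      - x (t + s))) =
    (fun h : R => h^-1 *: ((x \o shift (t + s)) (h *: 1) - x (t + s))).
    by apply/funext => h; rewrite /= addrCA.
  have [dx dxE] := xd _ ts0; split; first by rewrite /derivable xE.
  by rewrite /derive xE.
exists (fun s => xs (t + s)); split; last split; last split; last split.
- by move=> s th s0 rth; rewrite xsE ?addrA// addr_ge0// ltW.
- by move=> th rth; rewrite TE.
(* Since [0 < t], the maximum with [- r] is inactive on the half-line, so the globally continuous
   extension can replace [x]. *)
- have xtE : {in [set s : R | - r <= s],
      (fun s => x (Num.max (- r) (t + s))) =1 (fun s => x (t + s))}.
    by move=> s /set_mem /= rs; rewrite max_r// ler_wpDl// ltW.
  refine (@subspace_eq_continuous _ _ _ _ _ xtE _).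
  apply: continuous_subspaceT => s.
  apply: (@continuous_comp _ _ _ (fun s => t + s)
    (fun s => x (Num.max (- r) s))).
    by apply: continuousD; [exact: cst_continuous|exact: cvg_id].
  exact: (within_ge_continuous _ _ xc).
- have [dx] := xd_shift 0 (lexx 0); rewrite addr0 => dxE.
  apply: cvg_dnbhs_at_right; rewrite -dxE /derive.
  have xE : (fun h : R => h^-1 *: (x (t + h) - x t)) =
    (fun h : R => h^-1 *: (((fun s => x (t + s)) \o shift 0) (h *: 1)
      - x (t + 0))).
    by apply/funext => h; rewrite /= !addr0 [h *: 1]mulr1.
  by rewrite xE; exact: dx.
- by move=> s s0; exact: xd_shift (ltW s0).
Qed.

Lemma flow_add q t h phi : 0 <= t -> 0 <= h ->
  T q (t + h) phi = T q h (T q t phi).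
Proof.
rewrite le_eqVlt => /predU1P[<-|t0] h0; first by rewrite add0r flow0.
have [x [x_sol TE]] := T_solution q phi.
have [y [y_sol TtE]] := T_solution q (T q t phi).
apply: phase_eq => // th rth; rewrite TE ?addr_ge0 ?(ltW t0)// TtE// -addrA.
have /f_uniq := is_solution_shift q phi x t t0 x_sol
   (fun th rth => TE _ _ (ltW t0) rth).
move=> /(_ _ y_sol) ->//.
by case/andP: rth => rth _; apply: (le_trans rth); rewrite lerDr.
Qed.

(** Compactness of the delay interval makes the continuity of [y (s + th)] in [s] uniform in [th],
    which is what the sup distance asks for. *)
Lemma flow_cvg_left q phi t : 0 < t ->
  cdist (T q s phi) (T q t phi) @[s --> t^'-] --> (0 : R).
Proof.
move=> t0; have [x [[xs [_ [_ [xc _]]]] TE]] := T_solution q phi.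
pose y s := x (Num.max (- r) s).
have yc : continuous y := within_ge_continuous _ _ xc.
have yE s th : 0 <= s -> segI r th -> proj1_sig (T q s phi) th = y (s + th).
  move=> s0 rth; rewrite TE// /y max_r//.
  by case/andP: rth => rth _; apply: (le_trans rth); rewrite lerDr.
have near_y (e : R) : 0 < e ->
    \forall s \near t, `[- r, 0] `<=` (fun th => `|y (s + th) - y (t + th)| <= e).
  move=> e0; have /compact_near_coveringP/(_ R (nbhs t)
    (fun s th => `|y (s + th) - y (t + th)| <= e)) := @segment_compact R (- r) 0.
  apply => th0 _.
  have e2 : 0 < e / 2 by rewrite divr_gt0.
  have yc2 : y (p.2 + p.1) @[p --> (th0, t)] --> y (t + th0).
    apply: (@cvg_comp _ _ _ (fun p : R * R => p.2 + p.1) y); last exact: yc.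
    by apply: cvgD; [exact: cvg_snd|exact: cvg_fst].
  have yc1 : y (t + p.1) @[p --> (th0, t)] --> y (t + th0).
    apply: (@cvg_comp _ _ _ (fun p : R * R => t + p.1) y); last exact: yc.
    by apply: cvgD; [exact: cvg_cst|exact: cvg_fst].
  move/cvgrPdist_le : yc2 => /(_ _ e2) H2; move/cvgrPdist_le : yc1 => /(_ _ e2).
  apply: filter_app; apply: filterS H2 => -[th s] /= h2 h1.
  rewrite (splitr e); apply: (le_trans (ler_distD (y (t + th0)) _ _)).
  by rewrite lerD// distrC.
apply/cvgrPdist_le => e e0; near=> s.
have s0 : 0 <= s by near: s; exact: nbhs_left_ge.
rewrite sub0r normrN ger0_norm ?cdist_ge0//; apply: cdist_le => // th rth.
rewrite yE// yE ?(ltW t0)//.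
have : `[- r, 0] `<=` (fun th => `|y (s + th) - y (t + th)| <= e).
  by near: s; apply: cvg_within; exact: near_y.
by apply; rewrite /= in_itv.
Unshelve. all: by end_near. Qed.

Context {L : R}.
Hypothesis L0 : 0 < L.
Hypothesis fL : forall q psi1 psi2,
  `|f q psi1 - f q psi2| <= L * cdist psi1 psi2.

(** At time [h] a segment shows old data and the values at times [k] in [(0, h]]; at the latter, the
    first-order expansion at 0 adds [k *: (f q psi1 - f q psi2)], controlled by [fL], up to an error
    [k * e]. *)
Lemma flow_lipschitz_near0 q psi1 psi2 (e : R) : 0 < e ->
  \forall h \near (0:R)^'+, cdist (T q h psi1) (T q h psi2) <=
    (1 + L * h) * cdist psi1 psi2 + e * h.
Proof.
move=> e0.
have [x [[xs [xsE [x_phi [_ [xd _]]]]] TxE]] := T_solution q psi1.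
have [y [[ys [ysE [y_phi [_ [yd _]]]]] TyE]] := T_solution q psi2.
have xs0 : xs 0 = psi1.
  by apply: phase_eq => // th rth; rewrite xsE// add0r x_phi.
have ys0 : ys 0 = psi2.
  by apply: phase_eq => // th rth; rewrite ysE// add0r y_phi.
rewrite xs0 in xd; rewrite ys0 in yd.
have xyd : h^-1 *: (x h - x 0) - h^-1 *: (y h - y 0) @[h --> (0 : R)^'+] -->
    f q psi1 - f q psi2 by exact: cvgB xd yd.
move/cvgrPdist_le : xyd => /(_ _ e0) /near_at_right0P[d [d0 dP]].
apply/near_at_right0P; exists d; split=> // h /andP[h0 hd].
have D0 := cdist_ge0 r0 psi1 psi2.
have rr0 : segI r 0 by rewrite /segI/= oppr_le0 r0 lexx.
have seg_le s : segI r s -> `|x s - y s| <= cdist psi1 psi2.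
  by move=> rs; rewrite x_phi// y_phi// le_cdist.
apply: cdist_le => // th rth; rewrite TxE ?(ltW h0)// TyE ?(ltW h0)//.
have [hth0|hth0] := leP (h + th) 0.
  apply: (le_trans (seg_le _ _)).
    by rewrite /segI/= hth0; case/andP: rth => rth _; rewrite ler_wpDl// ltW.
  by rewrite mulrDl mul1r -addrA lerDl addr_ge0// mulr_ge0// ?mulr_ge0 ?ltW.
set k := h + th in hth0 *.
have kh : k <= h by case/andP: rth => _ ?; rewrite /k; lra.
have {}dP := dP k; rewrite hth0 (le_lt_trans kh hd) in dP.
move/(_ isT) : dP; rewrite -scalerBr => dP.
(* An exact expansion at 0: the last term is [k] times the gap, at most [e], between the limit and
   the difference quotient. *)
have xyE : x k - y k = (x 0 - y 0) + (k *: (f q psi1 - f q psi2) -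
    k *: (f q psi1 - f q psi2 - k^-1 *: (x k - x 0 - (y k - y 0)))).
  have k0 : k != 0 by rewrite gt_eqF.
  rewrite (scalerBr k (f q psi1 - _)) scalerA divff// scale1r opprB.
  rewrite !opprB [k *: _ + _]addrC subrK.
  by rewrite addrACA [x 0 + _]addrC subrK addKr.
rewrite xyE; apply: (le_trans (ler_normD _ _)).
have -> : (1 + L * h) * cdist psi1 psi2 + e * h =
  cdist psi1 psi2 + (h * (L * cdist psi1 psi2) + h * e) by ring.
rewrite lerD// ?seg_le//; apply: (le_trans (ler_normB _ _)).
rewrite !normrZ gtr0_norm//; apply: lerD; apply: ler_pM => //; exact: ltW.
Qed.

Lemma flow_lipschitz q psi1 psi2 t : 0 <= t ->
  cdist (T q t psi1) (T q t psi2) <= expR (L * t) * cdist psi1 psi2.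
Proof.
move=> t0; rewrite -{2}(flow0 q psi1) -{2}(flow0 q psi2).
apply: (@dini_gronwall _ (fun t => cdist (T q t psi1) (T q t psi2))) => //.
- by move=> *; exact: cdist_ge0.
- move=> {}t {}t0; apply/cvgrPdist_le => e e0.
  have e2 : 0 < e / 2 by rewrite divr_gt0.
  have /cvgrPdist_le /(_ _ e2) H1 := flow_cvg_left q psi1 t t0.
  have /cvgrPdist_le /(_ _ e2) H2 := flow_cvg_left q psi2 t t0.
  near=> s.
  have : `|0 - cdist (T q s psi1) (T q t psi1)| <= e / 2 by near: s.
  have : `|0 - cdist (T q s psi2) (T q t psi2)| <= e / 2 by near: s.
  rewrite !sub0r !normrN !(ger0_norm (cdist_ge0 _ _ _))// => s2 s1.
  have D1 := cdist_triangle r0 (T q s psi1) (T q t psi1) (T q s psi2).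
  have D2 := cdist_triangle r0 (T q t psi1) (T q t psi2) (T q s psi2).
  have D3 := cdist_triangle r0 (T q t psi1) (T q s psi1) (T q t psi2).
  have D4 := cdist_triangle r0 (T q s psi1) (T q s psi2) (T q t psi2).
  rewrite ler_norml; apply/andP; split.
    have := cdistC (T q t psi2) (T q s psi2); lra.
  have := cdistC (T q t psi1) (T q s psi1); lra.
- move=> {}t {}t0 e e0.
  have := flow_lipschitz_near0 q (T q t psi1) (T q t psi2) e e0.
  apply: filter_app; near=> h.
  have h0 : 0 <= h by near: h; exact: nbhs_right_ge.
  by rewrite -!flow_add.
Unshelve. all: by end_near. Qed.

End Flow.

(** * Auxiliary bounds on powers, the exponential and limits superior *)

Lemma cvg_powR {R : realType} {I : Type} {F : set_system I} {FF : Filter F}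
    (u : I -> R) (l p : R) : 0 < p -> 0 <= l -> (forall i, 0 <= u i) ->
  u i @[i --> F] --> l -> u i `^ p @[i --> F] --> l `^ p.
Proof.
(* A zero limit is treated apart: for [p < 1] the power is not differentiable at 0. *)
move=> p0; rewrite le_eqVlt => /predU1P[<-|l0] u0 ul.
  rewrite powR0 ?gt_eqF//; apply/cvgrPdist_le => e e0.
  move/cvgrPdist_le : ul => /(_ _ (powR_gt0 p^-1 e0)).
  apply: filterS => i; rewrite !sub0r !normrN ger0_norm// ger0_norm ?powR_ge0//.
  move=> /(ge0_ler_powR (ltW p0)); rewrite !nnegrE u0 powR_ge0 => /(_ isT isT).
  by rewrite -powRrM mulVf ?gt_eqF// powRr1 ?(ltW e0).
have pc : {for l, continuous (fun x : R => x `^ p)}.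
  apply: differentiable_continuous; apply/derivable1_diffP.
  by apply: derivable_powR; rewrite in_itv/= l0.
exact: (@cvg_comp _ _ _ u (fun x => x `^ p)) ul pc.
Qed.

(** Invert [1 - x <= expR (- x)] and use [(1 - x) * (1 + 2 * x) >= 1] on this range. *)
Lemma expR_le_1Dx2 {R : realType} (x : R) : 0 <= x <= 2^-1 -> expR x <= 1 + 2 * x.
Proof.
move=> /andP[x0 x2].
have e0 := expR_gt0 x; have := expR_ge1Dx (- x); rewrite expRN => ex.
have : (1 - x) * expR x <= 1 by rewrite -ler_pdivlMr// div1r.
have x1 : 0 < 1 - x by lra.
rewrite -ler_pdivlMl// mulr1 => /le_trans; apply.
by rewrite -div1r ler_pdivrMr//; nra.
Qed.

Lemma limf_esup_lt_near {R : realType} (g : R -> R) (F : set_system R) (B : R) :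
  Filter F -> (limf_esup (fun h => (g h)%:E) F < B%:E)%E ->
  \forall h \near F, g h < B.
Proof.
move=> FF /ereal_inf_lt[_ [A FA <-] AB].
apply: filterS FA => h Ah; rewrite -lte_fin; apply: le_lt_trans AB.
by apply: ereal_sup_ubound; exists h.
Qed.

Lemma limf_esup_le_near {R : realType} (g : R -> R) (F : set_system R) (B : R) :
  (\forall h \near F, g h <= B) -> (limf_esup (fun h => (g h)%:E) F <= B%:E)%E.
Proof.
move=> gB; apply: ge_ereal_inf.
exists (ereal_sup ((fun h => (g h)%:E) @` [set h | g h <= B])).
  by exists [set h | g h <= B].
by apply: ge_ereal_sup => _ [h /= ghB <-]; rewrite lee_fin.
Qed.

(** * Switching signals: prepending a mode, propagating estimates *)

Section Switching.
Context {R : realType} {r : R} {n : nat} {Q : Type}.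
Context {T : Q -> R -> phase r n -> phase r n}.

Lemma switching_times_ge0 (ts : nat -> R) k : switching_times ts -> 0 <= ts k.
Proof.
move=> [t0 [tS _]]; elim: k => [|k IH]; first by rewrite t0.
exact: le_trans IH (ltW (tS k)).
Qed.

Lemma switching_times_nat : switching_times (fun k => k%:R : R).
Proof.
split=> //; split=> [k|M]; first by rewrite ltr_nat.
by exists (Num.trunc M).+1; exact: truncnS_gt.
Qed.

Definition prepend_times (h : R) (ts : nat -> R) (k : nat) : R :=
  if k is k'.+1 then ts k' + h else 0.

Definition prepend_mode (q : Q) (qs : nat -> Q) (k : nat) : Q :=
  if k is k'.+1 then qs k' else q.

Lemma switching_times_prepend (h : R) ts :
  0 < h -> switching_times ts -> switching_times (prepend_times h ts).
Proof.
move=> h0 [t0 [tS tM]]; split=> //; split=> [[|k]|M] /=.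
- by rewrite t0 add0r.
- by rewrite ltrD2r.
- by have [k Mk] := tM (M - h); exists k.+1; rewrite /= -ltrBlDr.
Qed.

Lemma sw_flow_prepend q qs (h : R) ts psi k t : switching_times ts ->
  sw_flow T (prepend_mode q qs) (prepend_times h ts) psi k.+1 (t + h) =
  sw_flow T qs ts (T q h psi) k t.
Proof.
move=> [t0 _]; rewrite /sw_flow.
suff -> : sw_state T (prepend_mode q qs) (prepend_times h ts) psi k.+1 =
    sw_state T qs ts (T q h psi) k.
  by rewrite /= opprD addrACA subrr addr0.
elim: k => [|k IH]; first by rewrite /= t0 add0r subr0.
by rewrite -[LHS]/(T _ _ (sw_state T _ _ psi k.+1)) IH /= opprD addrACA subrr addr0.
Qed.

(** [G] takes two phases so that one induction on the switching instants serves both the Lipschitz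
    bound, with [cdist], and the decay of a functional of one phase, with the second argument
    ignored. *)
Lemma sw_flow_growth (G : phase r n -> phase r n -> R) (a : R) :
  (forall q psi1 psi2 t, 0 <= t ->
     G (T q t psi1) (T q t psi2) <= expR (a * t) * G psi1 psi2) ->
  forall qs ts psi1 psi2 k t, switching_times ts -> ts k <= t ->
    G (sw_flow T qs ts psi1 k t) (sw_flow T qs ts psi2 k t) <=
    expR (a * t) * G psi1 psi2.
Proof.
move=> TG qs ts psi1 psi2 k t ts_sw kt.
suff H : G (sw_state T qs ts psi1 k) (sw_state T qs ts psi2 k) <=
    expR (a * ts k) * G psi1 psi2.
  have kt0 : 0 <= t - ts k by rewrite subr_ge0.
  apply: (le_trans (TG _ _ _ _ kt0)).
  apply: (le_trans (ler_wpM2l (expR_ge0 _) H)).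
  by rewrite mulrA -expRD -mulrDr subrK.
elim: k {kt} => [|k IH] /=.
  by case: ts_sw => -> _; rewrite mulr0 expR0 mul1r.
have kt0 : 0 <= ts k.+1 - ts k by case: ts_sw => _ [tS _]; rewrite subr_ge0 ltW.
apply: (le_trans (TG _ _ _ _ kt0)).
apply: (le_trans (ler_wpM2l (expR_ge0 _) IH)).
by rewrite mulrA -expRD -mulrDr subrK.
Qed.

End Switching.

(** * From exponential stability to a Lyapunov functional *)

Section Converse.
Context {R : realType} {r : R} {n : nat} {Q : Type}.
Context {T : Q -> R -> phase r n -> phase r n}.
Hypothesis r0 : 0 <= r.
Hypothesis Q0 : inhabited Q.
Hypothesis T0 : forall q psi, T q 0 psi = psi.
Context {M mu : R}.
Hypothesis mu0 : 0 < mu.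
Hypothesis M0 : 0 < M.
Hypothesis ges : forall qs ts, switching_times ts ->
  forall psi k t, ts k <= t < ts k.+1 ->
  cnorm (sw_flow T qs ts psi k t) <= M * expR (- (mu + mu) * t) * cnorm psi.

(** The weight [expR (mu * t)] spends only half of the decay rate [mu + mu]; the remaining factor
    [expR (- (mu * t))] makes late times negligible, as continuity will require. *)
Definition peak_set (psi : phase r n) : set R := [set v | exists qs ts k t,
  [/\ switching_times ts, ts k <= t < ts k.+1 &
      v = expR (mu * t) * cnorm (sw_flow T qs ts psi k t)]].

Definition peak psi : R := sup (peak_set psi).

Lemma peak_flow_le qs ts psi k t : switching_times ts -> ts k <= t < ts k.+1 ->
  expR (mu * t) * cnorm (sw_flow T qs ts psi k t) <=
  M * expR (- (mu * t)) * cnorm psi.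
Proof.
move=> ts_sw kt.
apply: (le_trans (ler_wpM2l (expR_ge0 _) (ges qs ts ts_sw psi k t kt))).
rewrite (_ : - (mu * t) = mu * t + - (mu + mu) * t); last by ring.
rewrite expRD le_eqVlt; apply/orP; left; apply/eqP; ring.
Qed.

Lemma cnorm_in_peak_set psi : peak_set psi (cnorm psi).
Proof.
(* Any signal returns the initial phase at time 0; a constant mode with switching instants at the
   integers is one. *)
case: Q0 => q; exists (fun=> q), (fun k => k%:R), 0%N, 0; split.
- exact: switching_times_nat.
- by rewrite lexx ltr01.
- by rewrite /sw_flow /= subrr T0 mulr0 expR0 mul1r.
Qed.

Lemma peak_le psi B : (forall qs ts k t, switching_times ts ->
    ts k <= t < ts k.+1 ->
    expR (mu * t) * cnorm (sw_flow T qs ts psi k t) <= B) ->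
  peak psi <= B.
Proof.
move=> H; apply: ge_sup; first by exists (cnorm psi); exact: cnorm_in_peak_set.
by move=> _ [qs [ts [k [t [? ? ->]]]]]; exact: H.
Qed.

Lemma peak_set_ub psi : ubound (peak_set psi) (M * cnorm psi).
Proof.
move=> _ [qs [ts [k [t [ts_sw kt ->]]]]].
apply: (le_trans (peak_flow_le _ _ _ _ _ ts_sw kt)).
rewrite ler_wpM2r ?cnorm_ge0// ler_piMr ?(ltW M0)// -expR0 ler_expR oppr_le0.
rewrite mulr_ge0 ?(ltW mu0)//; case/andP: kt => kt _; apply: le_trans kt.
exact: switching_times_ge0.
Qed.

Lemma le_peak qs ts psi k t : switching_times ts -> ts k <= t < ts k.+1 ->
  expR (mu * t) * cnorm (sw_flow T qs ts psi k t) <= peak psi.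
Proof.
move=> ts_sw kt; apply: ub_le_sup.
  by exists (M * cnorm psi); exact: peak_set_ub.
by exists qs, ts, k, t.
Qed.

Lemma cnorm_le_peak psi : cnorm psi <= peak psi.
Proof.
apply: ub_le_sup; first by exists (M * cnorm psi); exact: peak_set_ub.
exact: cnorm_in_peak_set.
Qed.

Lemma peak_le_cnorm psi : peak psi <= M * cnorm psi.
Proof.
apply: ge_sup (peak_set_ub psi).
by exists (cnorm psi); exact: cnorm_in_peak_set.
Qed.

Lemma peak_decay q h psi : 0 < h -> peak (T q h psi) <= expR (- (mu * h)) * peak psi.
Proof.
move=> h0; apply: peak_le => qs ts k t ts_sw kt.
rewrite expRN ler_pdivlMl ?expR_gt0// mulrA -expRD -mulrDr (addrC h).
rewrite -(sw_flow_prepend q qs h) //; apply: le_peak => /=.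
  exact: switching_times_prepend.
by rewrite lerD2r ltrD2r.
Qed.

(** For [x = mu * h <= 1], [expR (- x) <= 1 - x / 2] because [(1 + x) * (1 - x / 2) >= 1]; the
    factor [2 / mu] normalizes the resulting slope [- mu / 2] to [- 1]. *)
Lemma peak_dini q psi :
  (upper_dini T (fun psi => 2 / mu * peak psi)%R q psi <= (- cnorm psi)%:E)%E.
Proof.
have mu_inv : 0 < mu^-1 by rewrite invr_gt0.
apply: limf_esup_le_near; near=> h.
have h0 : 0 < h by near: h; exact: nbhs_right_gt.
have hmu : h <= mu^-1 by near: h; exact: nbhs_right_le.
have p0 : 0 <= peak psi by exact: le_trans (cnorm_ge0 r0 psi) (cnorm_le_peak psi).
have muh0 : 0 < mu * h by rewrite mulr_gt0.
have muh1 : mu * h <= 1 by rewrite mulrC -ler_pdivlMr// div1r.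
have emuh : expR (- (mu * h)) <= 1 - mu * h / 2.
  rewrite expRN -div1r ler_pdivrMr ?expR_gt0//.
  have := expR_ge1Dx (mu * h); nra.
rewrite ler_pdivrMr// -mulrBr.
have : peak (T q h psi) - peak psi <= - (mu * h / 2) * peak psi.
  have := peak_decay q h psi h0; have := ler_wpM2r p0 emuh; lra.
move=> /(ler_wpM2l (ltW (divr_gt0 (ltr0Sn R 1) mu0)))/le_trans; apply.
rewrite (_ : 2 / mu * (- (mu * h / 2) * peak psi) = - peak psi * h); last first.
  by field; rewrite gt_eqF.
by rewrite ler_pM2r// lerN2 cnorm_le_peak.
Unshelve. all: by end_near. Qed.

Context {L : R}.
Hypothesis L0 : 0 < L.
Hypothesis T_lip : forall q psi1 psi2 t, 0 <= t ->
  cdist (T q t psi1) (T q t psi2) <= expR (L * t) * cdist psi1 psi2.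

(** Up to [t1], trajectories under the same signal stay close by the Lipschitz bound; past [t1], the
    weighted norm from [psi1] is already at most [e]. *)
Lemma peak_modulus (C e : R) : 0 <= C -> 0 < e -> exists2 d : R, 0 < d &
  forall psi1 psi2, cnorm psi1 <= C -> cdist psi1 psi2 <= d ->
    peak psi1 <= peak psi2 + e.
Proof.
move=> C0 e0.
(* Chosen with [mu * t1 = M * C / e], so that [expR (mu * t) >= mu * t] beats [M * C / e] beyond
   [t1]. *)
pose t1 := M * C / (e * mu).
have t10 : 0 <= t1 by rewrite divr_ge0 ?mulr_ge0 ?(ltW M0) ?(ltW e0) ?(ltW mu0).
(* [d] offsets the weight and the Lipschitz growth together, at most [expR ((mu + L) * t1)]. *)
pose d := e * expR (- ((mu + L) * t1)).
exists d; first by rewrite mulr_gt0 ?expR_gt0.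
move=> psi1 psi2 psiC psid; apply: peak_le => qs ts k t ts_sw kt.
have t0 : 0 <= t.
  by case/andP: kt => kt _; apply: le_trans kt; exact: switching_times_ge0.
have [tt1|t1t] := leP t t1.
  have [kt' _] := andP kt.
  have flow_lip := sw_flow_growth cdist L T_lip qs ts psi1 psi2 k t ts_sw kt'.
  have := cnorm_le_cdist r0 (sw_flow T qs ts psi1 k t) (sw_flow T qs ts psi2 k t).
  move=> /(ler_wpM2l (expR_ge0 (mu * t)))/le_trans; apply.
  rewrite mulrDr lerD ?le_peak//.
  apply: (le_trans (ler_wpM2l (expR_ge0 _) flow_lip)).
  rewrite mulrA -expRD -mulrDl.
  apply: (le_trans (ler_wpM2l (expR_ge0 _) psid)).
  rewrite /d mulrCA -expRD ler_piMr ?(ltW e0)// -expR0 ler_expR.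
  by rewrite subr_le0 ler_wpM2l// addr_ge0// ltW.
apply: (le_trans (peak_flow_le _ _ _ _ _ ts_sw kt)).
apply: (@le_trans _ _ e); last first.
  by rewrite lerDr; exact: le_trans (cnorm_ge0 r0 psi2) (cnorm_le_peak psi2).
rewrite expRN mulrAC ler_pdivrMr ?expR_gt0//.
apply: (@le_trans _ _ (M * C)); first by rewrite ler_wpM2l// ltW.
rewrite -ler_pdivrMl//; apply: (@le_trans _ _ (mu * t1)).
  by rewrite /t1 (_ : mu * _ = e^-1 * (M * C))//; field; rewrite !gt_eqF.
have := expR_ge1Dx (mu * t).
have : mu * t1 <= mu * t by rewrite ler_pM2l// ltW.
lra.
Qed.

Lemma peak_continuous : ccontinuous (fun psi => 2 / mu * peak psi : R^o).
Proof.
move=> psi e e0.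
have c0 : 0 < 2 / mu by rewrite divr_gt0.
have e1 : 0 < e / (2 / mu) / 2 by rewrite !divr_gt0.
(* This bound also covers the norm of every phase within distance 1 of [psi], so the one-sided
   modulus applies in both directions. *)
have C0 : 0 <= cnorm psi + 1 by rewrite addr_ge0 ?cnorm_ge0.
have [d d0 dP] := peak_modulus _ _ C0 e1.
exists (Num.min 1 d); split; first by rewrite lt_min ltr01.
move=> psi'; rewrite lt_min => /andP[d1 dd].
have psi'C : cnorm psi' <= cnorm psi + 1.
  by apply: (le_trans (cnorm_le_cdist r0 psi' psi)); rewrite lerD2l cdistC ltW.
have psiC : cnorm psi <= cnorm psi + 1 by rewrite lerDl.
have H1 := dP _ _ psiC (ltW dd).
have H2 : peak psi' <= peak psi + e / (2 / mu) / 2.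
  by apply: dP psi'C _; rewrite cdistC ltW.
rewrite -mulrBr normrM gtr0_norm// mulrC -ltr_pdivlMr//.
rewrite ltr_norml; apply/andP; split; lra.
Qed.

End Converse.

(** * Limits of continuous functionals along families of phases *)

Lemma ccontinuous_cvg {R : realType} {r : R} {n : nat} {I : Type}
    {F : set_system I} {FF : Filter F} {W : normedModType R}
    (V : phase r n -> W) (u : I -> phase r n) psi :
  0 <= r -> ccontinuous V -> cdist (u i) psi @[i --> F] --> (0 : R) ->
  V (u i) @[i --> F] --> V psi.
Proof.
move=> r0 Vc upsi; apply/cvgrPdist_lt => e e0.
have [d [d0 dP]] := Vc psi e e0.
move/cvgrPdist_lt : upsi => /(_ _ d0); apply: filterS => i.
rewrite sub0r normrN ger0_norm ?cdist_ge0// => ud.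
by apply: dP; rewrite cdistC.
Qed.

Lemma cnorm_continuous {R : realType} {r : R} {n : nat} : 0 <= r ->
  ccontinuous (fun psi : phase r n => cnorm psi : R^o).
Proof.
move=> r0 psi e e0; exists e; split=> // psi' psie.
have := cnorm_le_cdist r0 psi psi'; have := cnorm_le_cdist r0 psi' psi.
by rewrite cdistC ltr_norml => *; apply/andP; split; lra.
Qed.

(** * From a functional without lower bound to exponential stability *)

Section Direct.
Context {R : realType} {r : R} {n : nat} {Q : Type}.
Context {T : Q -> R -> phase r n -> phase r n}.
Hypothesis r0 : 0 <= r.
Hypothesis T0 : forall q psi, T q 0 psi = psi.
Hypothesis T_add : forall q t h psi, 0 <= t -> 0 <= h ->
  T q (t + h) psi = T q h (T q t psi).
Hypothesis T_cvg : forall q psi t, 0 < t ->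
  cdist (T q s psi) (T q t psi) @[s --> t^'-] --> (0 : R).
Context {L : R}.
Hypothesis L0 : 0 < L.
Hypothesis T_growth : forall q psi t, 0 <= t ->
  cnorm (T q t psi) <= expR (L * t) * cnorm psi.
Context {V : phase r n -> R} {p c : R}.
Hypothesis V0 : forall psi, 0 <= V psi.
Hypothesis p0 : 0 < p.
Hypothesis c0 : 0 < c.
Hypothesis V_cvg : forall psi q t, 0 < t ->
  V (T q s psi) @[s --> t^'-] --> V (T q t psi).
Hypothesis V_dini : forall psi q,
  (upper_dini T V q psi <= (- cnorm psi `^ p)%:E)%E.
Hypothesis V_le : forall psi, V psi <= c * cnorm psi `^ p.

(** [2 * (L * p)] absorbs the growth of the power of the norm, the factor 2 coming from
    [expR_le_1Dx2]; the extra 1 leaves a net decay equal to that power. *)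
Let A : R := 2 * (L * p) + 1.
(** [A * c + 1] bounds [coercive_lyapunov] relative to the power of the norm, so the net decay
    becomes a rate [mu]. *)
Let mu : R := (A * c + 1)^-1.

Definition coercive_lyapunov (psi : phase r n) : R := A * V psi + cnorm psi `^ p.

Let A1 : 1 <= A.
Proof. by rewrite /A lerDr !mulr_ge0// ltW. Qed.

Let A0 : 0 < A. Proof. exact: lt_le_trans ltr01 A1. Qed.

Let Ac0 : 0 < A * c + 1.
Proof. by rewrite addr_gt0// mulr_gt0. Qed.

Let mu_gt0 : 0 < mu. Proof. by rewrite invr_gt0. Qed.

Lemma coercive_lyapunov_le psi :
  mu * coercive_lyapunov psi <= cnorm psi `^ p.
Proof.
rewrite ler_pdivrMl// mulrDl mul1r -mulrA lerD2r ler_wpM2l//; exact: ltW.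
Qed.

Lemma cnorm_le_coercive_lyapunov psi : cnorm psi `^ p <= coercive_lyapunov psi.
Proof. by rewrite /coercive_lyapunov lerDr mulr_ge0// ltW. Qed.

Lemma coercive_lyapunov_near0 q psi (e : R) : 0 < e ->
  \forall h \near (0 : R)^'+, coercive_lyapunov (T q h psi) <=
    (1 + - mu * h) * coercive_lyapunov psi + e * h.
Proof.
move=> e0; set N := cnorm psi `^ p.
(* The tolerance allowed for [V] becomes [e] once multiplied by [A]. *)
have eA0 : 0 < e / A by rewrite divr_gt0.
have Lp0 : 0 < L * p by rewrite mulr_gt0.
(* Below this threshold [L * h * p] lies in the range of [expR_le_1Dx2]. *)
have Lp2 : 0 < 2^-1 / (L * p) by rewrite divr_gt0.
have N0 : 0 <= N by exact: powR_ge0.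
have NeA : (upper_dini T V q psi < (- N + e / A)%:E)%E.
  by apply: (le_lt_trans (V_dini psi q)); rewrite lte_fin -/N ltrDl.
near=> h.
have h0 : 0 < h by near: h; exact: nbhs_right_gt.
have hLp : h <= 2^-1 / (L * p) by near: h; exact: nbhs_right_le.
have Vh : (V (T q h psi) - V psi) / h < - N + e / A.
  by near: h; exact: limf_esup_lt_near NeA.
have {}Vh : A * V (T q h psi) <= A * V psi - A * N * h + e * h.
  move: Vh; rewrite ltr_pdivrMr// => /ltW.
  rewrite -(ler_pM2l A0).
  have -> : A * ((- N + e / A) * h) = - (A * N * h) + e * h.
    by field; rewrite gt_eqF.
  lra.
have Nh : cnorm (T q h psi) `^ p <= (1 + 2 * (L * p) * h) * N.
  have hLp' : 0 <= L * h * p <= 2^-1.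
    rewrite mulrAC mulr_ge0 ?(ltW h0) ?(ltW Lp0)//=.
    by rewrite mulrC -ler_pdivlMr.
  apply: (@le_trans _ _ (expR (L * h * p) * N)); last first.
    rewrite ler_wpM2r//; apply: (le_trans (expR_le_1Dx2 _ hLp')).
    by rewrite -!mulrA (mulrC h).
  rewrite expRM -powRM ?expR_ge0 ?cnorm_ge0//.
  apply: (ge0_ler_powR (ltW p0)); rewrite ?nnegrE ?mulr_ge0 ?expR_ge0 ?cnorm_ge0//.
  by rewrite T_growth// ltW.
have := coercive_lyapunov_le psi; rewrite -/N -(ler_pM2r h0) => UN.
rewrite /coercive_lyapunov in UN *; rewrite -/N in UN *.
have -> : (1 + - mu * h) * (A * V psi + N) + e * h =
  A * V psi + N - mu * (A * V psi + N) * h + e * h by ring.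
have AN : A * N * h = 2 * (L * p) * h * N + N * h by rewrite /A; ring.
lra.
Unshelve. all: by end_near. Qed.

Lemma coercive_lyapunov_decay q psi t : 0 <= t ->
  coercive_lyapunov (T q t psi) <= expR (- mu * t) * coercive_lyapunov psi.
Proof.
move=> t0; rewrite -{2}(T0 q psi).
apply: (@dini_gronwall _ (fun t => coercive_lyapunov (T q t psi))) => //.
- move=> s _; apply: le_trans (cnorm_le_coercive_lyapunov _); exact: powR_ge0.
- move=> {}t {}t0; apply: cvgD.
    by apply: cvgM; [exact: cvg_cst|exact: V_cvg].
  apply: cvg_powR => //; [exact: cnorm_ge0|by move=> s; exact: cnorm_ge0|].
  exact: (ccontinuous_cvg _ _ _ r0 (cnorm_continuous r0)) (T_cvg q psi t t0).
- move=> {}t {}t0 e e0.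
  have := coercive_lyapunov_near0 q (T q t psi) e e0.
  apply: filter_app; near=> h.
  have h0 : 0 <= h by near: h; exact: nbhs_right_ge.
  by rewrite -T_add.
Unshelve. all: by end_near. Qed.

Lemma lyapunov_UGES : UGES T.
Proof.
(* Both constants come from taking [p]-th roots in the decay estimate for the [p]-th power of the
   norm. *)
exists ((A * c + 1) `^ p^-1), (mu / p); split; first by rewrite powR_gt0.
split; first by rewrite divr_gt0.
move=> qs ts ts_sw psi k t /andP[kt _].
have t0 : 0 <= t by apply: le_trans kt; exact: switching_times_ge0.
have := sw_flow_growth (fun psi _ => coercive_lyapunov psi) (- mu)
  (fun q psi _ t t0 => coercive_lyapunov_decay q psi t t0)
  qs ts psi psi k t ts_sw kt.
move/(le_trans (cnorm_le_coercive_lyapunov _)).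
set phi := sw_flow _ _ _ _ _ _ => H.
have {}H : cnorm phi `^ p <= expR (- mu * t) * ((A * c + 1) * cnorm psi `^ p).
  apply: (le_trans H); rewrite ler_wpM2l ?expR_ge0//.
  by rewrite -ler_pdivrMl// coercive_lyapunov_le.
move: H => /(ge0_ler_powR (ltW (_ : 0 < p^-1))).
rewrite invr_gt0 !nnegrE powR_ge0 !mulr_ge0 ?expR_ge0 ?powR_ge0 ?(ltW Ac0)//.
move=> /(_ p0 isT isT).
rewrite !powRM ?mulr_ge0 ?expR_ge0 ?powR_ge0 ?(ltW Ac0)//.
rewrite -!powRrM mulfV ?gt_eqF// !powRr1 ?cnorm_ge0// -expRM.
by rewrite mulrA (mulrC (expR _)) !mulNr (mulrAC mu).
Qed.

End Direct.

(** * The cycle of implications from (i) through (ii) and (iii) back to (i) *)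

Theorem theorem7 (R : realType) (r : R) (n : nat) (Q : Type)
  (f : Q -> phase r n -> 'rV[R]_n)
  (T : Q -> R -> phase r n -> phase r n)
  (hr : 0 <= r) (hn : (0 < n)%N) (hQ : inhabited Q)
  (hfcont : forall q, ccontinuous (f q))
  (hf0 : forall q (psi : phase r n),
      (forall s, proj1_sig psi s = 0) -> f q psi = 0)
  (huniq : forall q phi x y, is_solution f q phi x -> is_solution f q phi y ->
      forall t, - r <= t -> x t = y t)
  (hT : forall q phi, exists x, is_solution f q phi x /\
      forall t th, 0 <= t -> segI r th -> proj1_sig (T q t phi) th = x (t + th))
  (hLip : exists L : R, 0 < L /\
      forall q psi1 psi2, `|f q psi1 - f q psi2| <= L * cdist psi1 psi2) :
  (UGES T <->
    exists V : phase r n -> R,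
      (forall psi, 0 <= V psi) /\ ccontinuous V /\
      exists p cl cu : R, 0 < p /\ 0 < cl /\ 0 < cu /\
        (forall psi, cl * cnorm psi `^ p <= V psi <= cu * cnorm psi `^ p) /\
        (forall psi q, (upper_dini T V q psi <= (- cnorm psi `^ p)%:E)%E))
  /\
  (UGES T <->
    exists V : phase r n -> R,
      (forall psi, 0 <= V psi) /\
      exists p c : R, 0 < p /\ 0 < c /\
        (forall psi q t, 0 < t ->
           V (T q s psi) @[s --> t^'-] --> V (T q t psi)) /\
        (forall psi q, (upper_dini T V q psi <= (- cnorm psi `^ p)%:E)%E) /\
        (forall psi, V psi <= c * cnorm psi `^ p)).
Proof.
have [L [L0 fL]] := hLip.
have T0 := flow0 hr hT.
have T_add := flow_add hr huniq hT.
have T_cvg := flow_cvg_left hr hT.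
have T_lip := flow_lipschitz hr huniq hT L0 fL.
have T_growth q psi t : 0 <= t -> cnorm (T q t psi) <= expR (L * t) * cnorm psi.
  move=> t0; rewrite !cnorm_cdist -{1}(flow_phase0 hr hf0 huniq hT q t t0).
  exact: T_lip.
set P2 := (X in (_ <-> X) /\ _); set P3 := (X in _ /\ (_ <-> X)).
have P12 : UGES T -> P2.
  move=> [M [lam [M0 [lam0 ges]]]].
  have mu0 : 0 < lam / 2 by rewrite divr_gt0.
  rewrite (splitr lam) in ges.
  have c0 : 0 < 2 / (lam / 2) by rewrite divr_gt0.
  exists (fun psi => 2 / (lam / 2) * peak (T := T) (mu := lam / 2) psi); split.
    move=> psi; rewrite mulr_ge0 ?(ltW c0)//.
    exact: le_trans (cnorm_ge0 hr psi) (cnorm_le_peak hr hQ T0 mu0 M0 ges psi).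
  split; first exact (peak_continuous hr hQ T0 mu0 M0 ges L0 T_lip).
  (* The peak lies between the norm and [M] times the norm, which gives the exponent 1 and both
     constants. *)
  exists 1, (2 / (lam / 2)), (2 / (lam / 2) * M).
  do 2 (split=> //); split; first by rewrite mulr_gt0.
  split=> [psi|psi q]; rewrite powRr1 ?cnorm_ge0//.
    rewrite -(mulrA _ M); apply/andP; split; rewrite ler_pM2l//.
      exact (cnorm_le_peak hr hQ T0 mu0 M0 ges psi).
    exact (peak_le_cnorm hr hQ T0 mu0 M0 ges psi).
  exact (peak_dini hr hQ T0 mu0 M0 ges q psi).
have P23 : P2 -> P3.
  move=> [V [V0 [Vc [p [cl [cu [p0 [_ [cu0 [Vb Vd]]]]]]]]]].
  exists V; split=> //; exists p, cu; do 2 split=> //; split.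
    (* Continuity of [V] composed with left continuity of the flow in the sup distance. *)
    move=> psi q t t0.
    exact: (ccontinuous_cvg _ _ _ hr Vc) (T_cvg q psi t t0).
  by split=> // psi; case/andP: (Vb psi).
have P31 : P3 -> UGES T.
  move=> [V [V0 [p [c [p0 [c0 [V_cvg [Vd Vle]]]]]]]].
  exact (lyapunov_UGES hr T0 T_add T_cvg L0 T_growth V0 p0 c0 V_cvg Vd Vle).
by split; split=> //; [move=> /P23/P31|move=> /P12/P23].
Qed.
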